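(* Let $\{x_k\}$, $\{\|F(x_k)\|\}$ and $\{\lambda_k\}$ be the sequences generated by the GIQN-CondG method (described in the context, with associated quantities $M_k$, $r_k$, $\theta_k$, $p_k$, $\alpha$). Then: (i) The sequence $\{\|F(x_k)\|\}$ is convergent. (ii) The sequence $\{\lambda_k\|F(x_k)\|\}$ is convergent and $\lim_{k\to\infty}\lambda_k\|F(x_k)\|=0$. (iii) If the inequality $\|F(x_k+p_k)\|\le(1-\alpha(1+\lambda_k))\|F(x_k)\|$ is satisfied for infinitely many $k$, then $\lim_{k\to\infty}\|F(x_k)\|=0$. If $\|F(x_k)\|\le\|F(x_{k+1})\|$ for all $k$ sufficiently large, then $\lim_{k\to\infty}\lambda_k=0$ and $\lim_{k\to\infty}\|F(x_k)\|\ne0$. (iv) If in addition there are scalars $c_1>0$ and $c_2\ge0$ such that, for every $k\ge0$, the approximation $M_k$ of $F'(x_k)$ is invertible with $\|M_k^{-1}\|\le c_1$ and $\|r_k\|\le c_2\|F(x_k)\|$, and if $\{\theta_k\}\subset[0,\beta^2/2]$ where $\beta\ge0$, then the sequence $\{x_k\}$ is convergent.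
   Context: Setting: $\Omega\subset\mathbb{R}^n$ is open, $F:\Omega\to\mathbb{R}^n$ is continuously differentiable with Jacobian $F'(x)$, and $C\subset\Omega$ is a nonempty convex compact set. $\langle\cdot,\cdot\rangle$ and $\|\cdot\|$ are the Euclidean inner product and its associated norm. CondG procedure. For $y\in\mathbb{R}^n$, $x\in C$, $\varepsilon\ge 0$, the output $z=\mathrm{CondG}(y,x,\varepsilon)$ is computed as follows. Set $z_1=x$, $t=1$. (P1) Compute an optimal solution $u_t$ of $g_t^*=\min_{u\in C}\langle z_t-y,u-z_t\rangle$. (P2) If $g_t^*\ge-\varepsilon$, set $z=z_t$ and stop; otherwise set $\alpha_t=\min\{1,-g_t^*/\|u_t-z_t\|^2\}$ and $z_{t+1}=z_t+\alpha_t(u_t-z_t)$. (P3) Replace $t$ by $t+1$ and go to (P1). GIQN-CondG method. Data: $x_0\in C$, $\alpha,\sigma\in(0,1)$, a positive sequence $\{\eta_k\}$ with $\sum_{k=0}^\infty\eta_k\le\eta<\infty$, and $\{\theta_j\}\subset[0,\infty)$. For $k=0,1,2,\dots$: (S.1) If $F(x_k)=0$, stop. (S.2) Choose an invertible approximation $M_k$ of $F'(x_k)$; for a residual $r_k\in\mathbb{R}^n$ compute $(s_k,y_k)$ with $M_ks_k=-F(x_k)+r_k$ and $y_k=x_k+s_k$. (S.3) If $y_k\in C$, set $\tilde s_k=s_k$; otherwise set $\tilde s_k=\mathrm{CondG}(y_k,x_k,\theta_k\|s_k\|^2)-x_k$. (S.4) Set $s_+=\tilde s_k$; set $s_-=-\tilde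 s_k$ if $\|\tilde s_k\|\ne0$ and $s_-=-s_k$ otherwise. For a trial step length $\lambda\in(0,1]$ and trial vector $\pi$ consider the conditions (A) $\|F(x_k+\pi)\|\le(1-\alpha(1+\lambda))\|F(x_k)\|$; (B) $\|F(x_k+\pi)\|\le(1+\eta_k-\alpha\lambda)\|F(x_k)\|$. Start with $\lambda=1$ and repeat the following: if $\pi=\lambda s_+$ satisfies (A), accept this $\pi$; else if $\pi=\lambda s_-$ satisfies $x_k+\pi\in C$ and (A), accept this $\pi$; else if $\|s_+\|\ne0$ and $\pi=\lambda s_+$ satisfies (B), accept this $\pi$; else if $\pi=\lambda s_-$ satisfies $x_k+\pi\in C$ and (B), accept this $\pi$; else replace $\lambda$ by $\sigma\lambda$ and repeat. (S.5) With $\lambda$ and $\pi$ the accepted step length and vector, set $\lambda_k=\lambda$, $p_k=\pi$, $x_{k+1}=x_k+p_k$. It is understood that each call to the CondG procedure terminates and that the method does not stop at (S.1), so that the generated sequences are infinite. *)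

(* Defs.v *)
From mathcomp Require Import all_boot all_order all_algebra.
From mathcomp Require Import all_classical all_reals all_analysis.

Set Implicit Arguments.
Unset Strict Implicit.
Unset Printing Implicit Defensive.

Import Order.TTheory GRing.Theory Num.Theory.
Import numFieldNormedType.Exports.

Local Open Scope classical_set_scope.
Local Open Scope ring_scope.

(* Vectors are rows and matrices act on the right, as for [jacobian]: the     *)
(* image of s under M is s *m M. The library norm on 'rV_n is the sup norm,   *)
(* so the Euclidean one is defined here; both induce the same topology.       *)

Definition dot (R : realType) (n : nat) (u v : 'rV[R]_n) : R :=
  \sum_i u 0 i * v 0 i.

Definition enorm (R : realType) (n : nat) (u : 'rV[R]_n) : R :=
  Num.sqrt (dot u u).

(* operator norm induced by [enorm] *)
Definition opnorm (R : realType) (n : nat) (A : 'M[R]_n) : R :=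
  sup [set enorm (v *m A) | v in [set v : 'rV[R]_n | enorm v <= 1]].

Definition C1_on (R : realType) (n : nat) (Omega : set 'rV[R]_n)
    (F : 'rV[R]_n -> 'rV[R]_n) : Prop :=
  (forall x, Omega x -> differentiable F x) /\
  {within Omega, continuous (jacobian F)}.

Definition condg_opt (R : realType) (n : nat) (C : set 'rV[R]_n)
    (y z u : 'rV[R]_n) : Prop :=
  C u /\ forall v, C v -> dot (z - y) (u - z) <= dot (z - y) (v - z).

(* [CondG C y eps x z]: some terminating run of the procedure started at x    *)
(* outputs z. It is a relation because the optimal solution u of the linear   *)
(* subproblem need not be unique; its optimal value is dot (x - y) (u - x).   *)
Inductive CondG (R : realType) (n : nat) (C : set 'rV[R]_n) (y : 'rV[R]_n)
    (eps : R) : 'rV[R]_n -> 'rV[R]_n -> Prop :=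
| CondG_stop x u :
    condg_opt C y x u -> - eps <= dot (x - y) (u - x) -> CondG C y eps x x
| CondG_step x u z :
    condg_opt C y x u -> dot (x - y) (u - x) < - eps ->
    CondG C y eps
      (x + Num.min 1 (- dot (x - y) (u - x) / enorm (u - x) ^+ 2) *: (u - x))
      z ->
    CondG C y eps x z.

Definition condA (R : realType) (n : nat) (F : 'rV[R]_n -> 'rV[R]_n)
    (alpha : R) (x : 'rV[R]_n) (lam : R) (p : 'rV[R]_n) : bool :=
  enorm (F (x + p)) <= (1 - alpha * (1 + lam)) * enorm (F x).

Definition condB (R : realType) (n : nat) (F : 'rV[R]_n -> 'rV[R]_n)
    (alpha eta : R) (x : 'rV[R]_n) (lam : R) (p : 'rV[R]_n) : bool :=
  enorm (F (x + p)) <= (1 + eta - alpha * lam) * enorm (F x).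

(* The vector accepted at trial step length lam, or None if lam is rejected.  *)
Definition trial (R : realType) (n : nat) (F : 'rV[R]_n -> 'rV[R]_n)
    (C : set 'rV[R]_n) (alpha eta : R) (x s st : 'rV[R]_n) (lam : R) :
    option 'rV[R]_n :=
  let sp := st in
  let sm := if enorm st != 0 then - st else - s in
  if condA F alpha x lam (lam *: sp) then Some (lam *: sp)
  else if (x + lam *: sm \in C) && condA F alpha x lam (lam *: sm)
  then Some (lam *: sm)
  else if (enorm sp != 0) && condB F alpha eta x lam (lam *: sp)
  then Some (lam *: sp)
  else if (x + lam *: sm \in C) && condB F alpha eta x lam (lam *: sm)
  then Some (lam *: sm)
  else None.

Definition line_search (R : realType) (n : nat) (F : 'rV[R]_n -> 'rV[R]_n)
    (C : set 'rV[R]_n) (alpha sigma eta : R) (x s st : 'rV[R]_n)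
    (lam : R) (p : 'rV[R]_n) : Prop :=
  exists m : nat,
    [/\ lam = sigma ^+ m,
        forall j : nat, (j < m)%N ->
          trial F C alpha eta x s st (sigma ^+ j) = None
      & trial F C alpha eta x s st lam = Some p].

(* One iteration from x to x'; s, y, st, p are s_k, y_k, \tilde s_k, p_k.     *)
Record giqn_step (R : realType) (n : nat) (F : 'rV[R]_n -> 'rV[R]_n)
    (C : set 'rV[R]_n) (alpha sigma eta theta : R) (x : 'rV[R]_n)
    (M : 'M[R]_n) (r s y st : 'rV[R]_n) (lam : R) (p x' : 'rV[R]_n) : Prop :=
  GiqnStep {
    giqn_nonstop : F x != 0;
    giqn_inv : M \in unitmx;
    giqn_newton : s *m M = - F x + r;
    giqn_trial_pt : y = x + s;
    giqn_feasible : C y -> st = s;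
    giqn_condg : ~ C y -> CondG C y (theta * enorm s ^+ 2) x (x + st);
    giqn_search : line_search F C alpha sigma eta x s st lam p;
    giqn_next : x' = x + p
  }.

(* Main.v *)
Require Import Defs.
From mathcomp Require Import all_boot all_order all_algebra.
From mathcomp Require Import all_classical all_reals all_analysis.
From mathcomp Require Import ring lra.

(** Write a_k for the Euclidean norm of F(x_k). Condition (A) implies
    condition (B), so every accepted step satisfies
    a_(k+1) + alpha lambda_k a_k <= (1 + eta_k) a_k with summable eta_k
    ([giqn_step_accepted]). Such a quasi-decreasing sequence converges and its
    decrements alpha lambda_k a_k are summable ([quasi_decreasing_cvg]), which
    gives (i) and (ii).

    For (iii), infinitely many occurrences of (A) make the limit L of a_k
    satisfy L <= (1 - alpha) L, hence L = 0. If instead a_k is eventually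
    nondecreasing, then L is at least some a_N, which is positive because the
    method does not stop, and lambda_k = (lambda_k a_k) / a_k tends to 0 / L.

    For (iv), the length of x_(k+1) - x_k is at most a constant times
    lambda_k a_k ([giqn_step_displacement]), which is summable, so x_k is a
    Cauchy sequence. The constant comes from two facts: s_k is the image of
    r_k - F(x_k) under the inverse of M_k ([newton_step_le]), and a CondG
    output is not much farther from its starting point than y_k is
    ([CondG_displacement]). *)

Set Implicit Arguments.
Unset Strict Implicit.
Unset Printing Implicit Defensive.

Import Order.TTheory GRing.Theory Num.Theory.
Import numFieldNormedType.Exports.

Local Open Scope classical_set_scope.
Local Open Scope ring_scope.

(** * Euclidean geometry of row vectors *)

Lemma dot_ge0 (R : realType) (n : nat) (u : 'rV[R]_n) : 0 <= dot u u.
Proof. by apply: sumr_ge0 => i _; rewrite -expr2 sqr_ge0. Qed.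

Lemma enorm_ge0 (R : realType) (n : nat) (u : 'rV[R]_n) : 0 <= enorm u.
Proof. exact: sqrtr_ge0. Qed.

Lemma sqr_enorm (R : realType) (n : nat) (u : 'rV[R]_n) :
  enorm u ^+ 2 = dot u u.
Proof. by rewrite sqr_sqrtr// dot_ge0. Qed.

Lemma dotNN (R : realType) (n : nat) (u v : 'rV[R]_n) :
  dot (- u) (- v) = dot u v.
Proof. by apply: eq_bigr => i _; rewrite !mxE mulrNN. Qed.

Lemma dot_sqrD (R : realType) (n : nat) (u v : 'rV[R]_n) :
  dot (u + v) (u + v) = dot u u + dot v v + 2 * dot u v.
Proof.
rewrite /dot mulr_sumr -!big_split/=; apply: eq_bigr => i _.
by rewrite !mxE; ring.
Qed.

Lemma enormZ (R : realType) (n : nat) (a : R) (u : 'rV[R]_n) :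
  enorm (a *: u) = `|a| * enorm u.
Proof.
rewrite /enorm.
have -> : dot (a *: u) (a *: u) = a ^+ 2 * dot u u.
  by rewrite /dot mulr_sumr; apply: eq_bigr => i _; rewrite !mxE; ring.
by rewrite sqrtrM ?sqr_ge0// sqrtr_sqr.
Qed.

Lemma enormN (R : realType) (n : nat) (u : 'rV[R]_n) : enorm (- u) = enorm u.
Proof. by rewrite /enorm dotNN. Qed.

Lemma normr_coord_le_enorm (R : realType) (n : nat) (u : 'rV[R]_n) i :
  `|u 0 i| <= enorm u.
Proof.
rewrite -sqrtr_sqr; apply: ler_wsqrtr; rewrite /dot (bigD1 i)//= -expr2 lerDl.
by apply: sumr_ge0 => j _; rewrite -expr2 sqr_ge0.
Qed.

Lemma enorm_eq0 (R : realType) (n : nat) (u : 'rV[R]_n) :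
  (enorm u == 0) = (u == 0).
Proof.
apply/eqP/eqP => [u0|->]; last by rewrite -(scale0r 0) enormZ normr0 mul0r.
apply/rowP => i; rewrite mxE; apply/eqP; rewrite -normr_le0 -u0.
exact: normr_coord_le_enorm.
Qed.

(** The topology of row vectors comes from the sup norm; this bound carries
    Euclidean estimates over to it. *)
Lemma normr_le_enorm (R : realType) (n : nat) (u : 'rV[R]_n) :
  `|u| <= enorm u.
Proof.
rewrite [leLHS]/Num.Def.normr/= mx_normrE bigmax_le ?enorm_ge0//= => -[i j] _.
by rewrite (ord1 i); exact: normr_coord_le_enorm.
Qed.

(** By the parallelogram law. It serves as a triangle inequality with a worse
    constant, which is harmless where only boundedness matters. *)
Lemma sqr_enormD_le (R : realType) (n : nat) (u v : 'rV[R]_n) :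
  enorm (u + v) ^+ 2 <= 2 * (enorm u ^+ 2 + enorm v ^+ 2).
Proof.
rewrite !sqr_enorm dot_sqrD.
have := dot_ge0 (u - v); rewrite dot_sqrD dotNN.
have -> : dot u (- v) = - dot u v.
  by rewrite /dot -sumrN; apply: eq_bigr => i _; rewrite !mxE mulrN.
by lra.
Qed.

(** A supremum in the reals is meaningful only for a bounded set; the bound
    below comes from the entries of the matrix, since each coordinate of a
    vector in the unit ball is at most 1 in absolute value. *)
Lemma enorm_mulmx_le (R : realType) (n : nat) (A : 'M[R]_n) (v : 'rV[R]_n) :
  enorm (v *m A) <= opnorm A * enorm v.
Proof.
have ubA : has_ubound [set enorm (w *m A) | w in [set w | enorm w <= 1]].
  exists (Num.sqrt (\sum_j (\sum_i `|A i j|) ^+ 2)) => _ [w /= w1 <-].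
  apply/ler_wsqrtr/ler_sum => j _; rewrite -expr2 -[leLHS]real_normK ?num_real//.
  rewrite lerXn2r ?nnegrE ?normr_ge0 ?sumr_ge0//.
  rewrite mxE (le_trans (ler_norm_sum _ _ _))//; apply: ler_sum => i _.
  rewrite normrM ler_piMl//.
  exact: le_trans (normr_coord_le_enorm w i) w1.
have [v0|v0] := eqVneq v 0.
  by move/eqP: (v0); rewrite -enorm_eq0 v0 mul0mx => /eqP ->; rewrite mulr0.
have nv : 0 < enorm v by rewrite lt_def enorm_eq0 v0 enorm_ge0.
rewrite -ler_pdivrMr//; apply: (ub_le_sup ubA).
exists ((enorm v)^-1 *: v) => /=.
  by rewrite enormZ gtr0_norm ?invr_gt0// mulVf ?gt_eqF.
by rewrite -scalemxAl enormZ gtr0_norm ?invr_gt0// mulrC.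
Qed.

(** * The conditional gradient procedure and the line search *)

Lemma convex_segment (R : realType) (n : nat) (C : set 'rV[R]_n)
    (x d : 'rV[R]_n) (t : R) :
  convex_set C -> C x -> C (x + d) -> 0 <= t -> t <= 1 -> C (x + t *: d).
Proof.
move=> Cconv Cx Cxd t0 t1.
have := Cconv (x + d) x (Itv01 t0 t1) (mem_set Cxd) (mem_set Cx).
rewrite inE/=; congr C.
rewrite /conv/= scalerDr scalerBl scale1r.
by rewrite addrAC [_ + (x - _)]addrC subrK.
Qed.

(** The iterates stay in C because each step length lies in [0, 1], and the
    stopping test on the minimizer u bounds the linear form on all of C. *)
Lemma CondG_out (R : realType) (n : nat) (C : set 'rV[R]_n) (y x z : 'rV[R]_n)
    (eps : R) :
  convex_set C -> 0 <= eps -> CondG C y eps x z -> C x ->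
  C z /\ forall v, C v -> - eps <= dot (z - y) (v - z).
Proof.
move=> Cconv eps0; elim=> {x z} [x u [_ umin] ueps|x u z [Cu _] ueps _ IH] Cx.
  by split=> // v /umin; exact: le_trans.
apply: IH; apply: convex_segment => //; first by rewrite addrC subrK.
  rewrite le_min ler01 divr_ge0 ?sqr_ge0//.
  by rewrite oppr_ge0 (le_trans (ltW ueps))// oppr_le0.
by rewrite ge_min lexx.
Qed.

(** Take the starting point x as the test vector in the inequality satisfied by
    the output z: the angle at z in the triangle y, z, x is then obtuse up to
    the tolerance, and the law of cosines compares zx with yx. *)
Lemma CondG_displacement (R : realType) (n : nat) (C : set 'rV[R]_n)
    (y x z : 'rV[R]_n) (eps : R) :
  convex_set C -> 0 <= eps -> CondG C y eps x z -> C x ->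
  enorm (z - x) ^+ 2 <= enorm (y - x) ^+ 2 + 2 * eps.
Proof.
move=> Cconv eps0 yz Cx.
have [_ /(_ x Cx)] := CondG_out Cconv eps0 yz Cx.
rewrite -dotNN !opprB => zx.
have := dot_ge0 (y - z).
have -> : y - x = (y - z) + (z - x) by rewrite addrA subrK.
by rewrite !sqr_enorm [dot (_ + (z - x)) _]dot_sqrD; lra.
Qed.

(** What the four acceptance branches have in common: (A) is stronger than (B),
    feasibility is either tested or follows from convexity, and each trial
    direction is, up to sign, s or st. *)
Lemma trial_accepted (R : realType) (n : nat) (F : 'rV[R]_n -> 'rV[R]_n)
    (C : set 'rV[R]_n) (alpha eta : R) (x s st p : 'rV[R]_n) (lam : R) :
  convex_set C -> 0 <= alpha -> 0 <= eta -> 0 <= lam <= 1 ->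
  C x -> C (x + st) -> trial F C alpha eta x s st lam = Some p ->
  [/\ C (x + p), condB F alpha eta x lam p
    & enorm p <= lam * Num.max (enorm s) (enorm st)].
Proof.
move=> Cconv a0 e0 /andP[l0 l1] Cx Cxst.
have AB q : condA F alpha x lam q -> condB F alpha eta x lam q.
  by move/le_trans; apply; rewrite ler_wpM2r ?enorm_ge0//; lra.
have Cp : C (x + lam *: st) by exact: convex_segment.
have np : enorm (lam *: st) <= lam * Num.max (enorm s) (enorm st).
  by rewrite enormZ ger0_norm// ler_wpM2l// le_max lexx orbT.
rewrite /trial /=; set sm := (if enorm st != 0 then - st else - s).
have nm : enorm (lam *: sm) <= lam * Num.max (enorm s) (enorm st).
  rewrite enormZ ger0_norm// ler_wpM2l// /sm.
  by case: ifP => _; rewrite ?enormN le_max lexx ?orbT.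
case: ifP => [/AB Bp [<-]//|_].
case: ifP => [/andP[/set_mem Cm /AB Bm] [<-]//|_].
case: ifP => [/andP[_ Bp] [<-]//|_].
by case: ifP => [/andP[/set_mem Cm Bm] [<-]//|].
Qed.

(** * Sequences and series *)

Lemma series_nonneg_cvg (R : realType) (u : nat -> R) (B : R) :
  (forall k, 0 <= u k) -> (forall k, series u k <= B) -> cvgn (series u).
Proof.
move=> u0 uB; apply: nondecreasing_is_cvgn.
  by apply/nondecreasing_seqP => k; rewrite seriesSr lerDl.
by exists B => _ [k _ <-].
Qed.

(** The product of the factors 1 + e k is at most the exponential of the sum of
    the e k. *)
Lemma quasi_decreasing_bounded (R : realType) (a e : nat -> R) (E : R) :
  (forall k, 0 <= a k) -> (forall k, 0 <= e k) ->
  (forall k, series e k <= E) -> (forall k, a k.+1 <= (1 + e k) * a k) ->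
  forall k, a k <= expR E * a 0%N.
Proof.
move=> a0 e0 eE ae k.
suff ak : a k <= expR (series e k) * a 0%N.
  by rewrite (le_trans ak)// ler_wpM2r// ler_expR.
elim: k => [|k IH]; first by rewrite seriesEnat/= big_geq// expR0 mul1r.
rewrite (le_trans (ae k))// seriesSr expRD mulrAC mulrC.
by rewrite ler_pM ?expR_ge1Dx// addr_ge0.
Qed.

(** A deterministic Robbins-Siegmund lemma. With B a bound of a, the sequence
    w k = a k + (sum of d) - B * (sum of e) is nonincreasing and bounded below;
    this bounds the sums of d, and then a converges as a combination of three
    convergent sequences. *)
Lemma quasi_decreasing_cvg (R : realType) (a d e : nat -> R) (E : R) :
  (forall k, 0 <= a k) -> (forall k, 0 <= d k) -> (forall k, 0 <= e k) ->
  (forall k, series e k <= E) ->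
  (forall k, a k.+1 + d k <= (1 + e k) * a k) ->
  cvgn a /\ cvgn (series d).
Proof.
move=> a0 d0 e0 eE ade; set B := expR E * a 0%N.
have B0 : 0 <= B by rewrite mulr_ge0 ?expR_ge0.
have aB k : a k <= B.
  apply: (quasi_decreasing_bounded a0 e0 eE) => j.
  by rewrite (le_trans _ (ade j))// lerDl.
pose w k := a k + series d k - B * series e k.
have wS k : w k.+1 <= w k.
  rewrite /w !seriesSr; have := ade k.
  have : e k * a k <= B * e k by rewrite mulrC ler_wpM2r.
  by lra.
have w_ni : nonincreasing_seq w by apply/nonincreasing_seqP.
have BeE k : B * series e k <= B * E by rewrite ler_wpM2l.
have d_ge0 k : 0 <= series d k by rewrite seriesEnat sumr_ge0.
have wcvg : cvgn w.
  apply: nonincreasing_is_cvgn => //; exists (- (B * E)) => _ [k _ <-].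
  by rewrite /w; have := BeE k; have := d_ge0 k; have := a0 k; lra.
have dcvg : cvgn (series d).
  apply: (@series_nonneg_cvg _ _ (w 0%N + B * E)) => // k.
  have := w_ni _ _ (leq0n k); rewrite {1}/w.
  by have := BeE k; have := a0 k; lra.
have ecvg : cvgn (series e) by exact: (series_nonneg_cvg e0 eE).
split=> //.
have -> : a = w - series d + B *: series e.
  by apply/funext => k; rewrite /w !fctE /= /GRing.scale/=; ring.
by apply: is_cvgD; [exact: is_cvgB|exact: is_cvgZl_tmp].
Qed.

(** Completeness of the space of row vectors: increments dominated by a
    convergent series make the sequence Cauchy. *)
Lemma row_summable_cvg (R : realType) (n : nat) (x : nat -> 'rV[R]_n)
    (b : nat -> R) :
  (forall k, `|x k.+1 - x k| <= b k) -> cvgn (series b) -> cvgn x.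
Proof.
move=> xb /cauchy_cvgP/cauchy_seriesP bc.
have xE : x = cst (x 0%N) + series (telescope x).
  by apply/funext => k; rewrite [LHS]eq_sum_telescope.
rewrite xE; apply: is_cvgD; first exact: is_cvg_cst.
apply/cauchy_cvgP/cauchy_seriesP => e /bc.
apply: filterS => k /=; apply: le_lt_trans.
apply: le_trans (le_trans (ler_norm_sum _ _ _) _) (ler_norm _).
by apply: ler_sum => i _; exact: xb.
Qed.

Lemma infinite_set_nat_ge (A : set nat) N :
  infinite_set A -> exists2 k, (N <= k)%N & A k.
Proof.
move=> Ainf; apply: contrapT => noA; apply: Ainf.
apply: (sub_finite_set _ (finite_II N)) => k Ak /=.
by rewrite ltnNge; apply/negP => Nk; apply: noA; exists k.
Qed.

(** * One iteration of the method *)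

(** The factor sqrt (2 * (1 + c2 ^+ 2)) stands in for 1 + c2 because
    [sqr_enormD_le] replaces the triangle inequality. *)
Lemma newton_step_le (R : realType) (n : nat) (M : 'M[R]_n)
    (f r s : 'rV[R]_n) (c1 c2 : R) :
  0 <= c1 -> M \in unitmx -> s *m M = - f + r ->
  opnorm (invmx M) <= c1 -> enorm r <= c2 * enorm f ->
  enorm s <= c1 * Num.sqrt (2 * (1 + c2 ^+ 2)) * enorm f.
Proof.
move=> c10 Mu sM Mc1 rc2.
have -> : s = (- f + r) *m invmx M by rewrite -sM mulmxK.
apply: le_trans (enorm_mulmx_le _ _) _; rewrite -mulrA.
apply: le_trans (ler_wpM2r (enorm_ge0 _) Mc1) _; rewrite ler_wpM2l//.
rewrite -(@ler_pXn2r _ 2) ?nnegrE ?mulr_ge0 ?enorm_ge0 ?sqrtr_ge0//.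
rewrite exprMn [in leRHS]sqr_sqrtr; last first.
  by rewrite mulr_ge0// addr_ge0// sqr_ge0.
apply: le_trans (sqr_enormD_le _ _) _; rewrite enormN -mulrA ler_wpM2l//.
rewrite mulrDl mul1r lerD2l -exprMn.
by rewrite lerXn2r// nnegrE ?enorm_ge0//; exact: le_trans (enorm_ge0 _) rc2.
Qed.

Section giqn_step_theory.
Context {R : realType} {n : nat} {F : 'rV[R]_n -> 'rV[R]_n}.
Context {C : set 'rV[R]_n} {alpha sigma eta theta : R}.
Context {x : 'rV[R]_n} {M : 'M[R]_n} {r s y st : 'rV[R]_n}.
Context {lam : R} {p x' : 'rV[R]_n}.
Context (Cconv : convex_set C).
Context (theta0 : 0 <= theta).
Context (Cx : C x).
Context (hstep : giqn_step F C alpha sigma eta theta x M r s y st lam p x').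

Let tol_ge0 : 0 <= theta * enorm s ^+ 2.
Proof. by rewrite mulr_ge0 ?sqr_ge0. Qed.

Lemma giqn_step_feasible : C (x + st).
Proof.
case: hstep => _ _ _ yE Cy nCy _ _.
have [/[dup] yC /Cy ->|/nCy cg] := pselect (C y); first by rewrite -yE.
by have [] := CondG_out Cconv tol_ge0 cg Cx.
Qed.

(** The tolerance theta * |s|^2 is proportional to the squared length of the
    Newton step, so projecting inexactly costs only a constant factor. *)
Lemma giqn_step_inexact_le : enorm st ^+ 2 <= (1 + 2 * theta) * enorm s ^+ 2.
Proof.
case: hstep => _ _ _ yE Cy nCy _ _.
have [/Cy ->|/nCy cg] := pselect (C y).
  by rewrite ler_peMl ?sqr_ge0//; have := theta0; lra.
have := CondG_displacement Cconv tol_ge0 cg Cx.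
have -> : x + st - x = st by rewrite addrC addKr.
have -> : y - x = s by rewrite yE addrC addKr.
by lra.
Qed.

Context (sigma01 : 0 < sigma < 1).

Lemma giqn_step_length : 0 < lam <= 1.
Proof.
case: hstep => _ _ _ _ _ _ [m [-> _ _]] _; case/andP: sigma01 => s0 s1.
by rewrite exprn_gt0// exprn_ile1 ?ltW.
Qed.

Context (alpha0 : 0 <= alpha).
Context (eta0 : 0 <= eta).

Lemma giqn_step_accepted :
  [/\ C x', enorm (F x') <= (1 + eta - alpha * lam) * enorm (F x)
    & enorm (x' - x) <= lam * Num.max (enorm s) (enorm st)].
Proof.
case: hstep => _ _ _ _ _ _ [m [_ _ acc]] ->.
have /andP[/ltW l0 l1] := giqn_step_length.
have [Cp Bp np] : [/\ C (x + p), condB F alpha eta x lam p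
    & enorm p <= lam * Num.max (enorm s) (enorm st)].
  by apply: trial_accepted acc; rewrite ?l0//; exact: giqn_step_feasible.
by rewrite (addrC x) addrK -(addrC x).
Qed.

(** The factor sqrt (1 + beta ^+ 2) is the cost of the inexact projection when
    2 * theta <= beta ^+ 2, and the other factor that of solving the Newton
    system; lam comes from the line search. *)
Lemma giqn_step_displacement (c1 c2 beta : R) :
  0 <= c1 -> opnorm (invmx M) <= c1 -> enorm r <= c2 * enorm (F x) ->
  theta <= beta ^+ 2 / 2 ->
  enorm (x' - x) <=
    Num.sqrt (1 + beta ^+ 2) * (c1 * Num.sqrt (2 * (1 + c2 ^+ 2))) *
    (lam * enorm (F x)).
Proof.
move=> c10 Mc1 rc2 thetab; have [_ _ xx'] := giqn_step_accepted.
case: (hstep) => _ Mu sM _ _ _ _ _.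
have sF := newton_step_le c10 Mu sM Mc1 rc2.
have /andP[/ltW l0 _] := giqn_step_length.
apply: le_trans xx' _; rewrite mulrCA ler_wpM2l// -mulrA.
apply: le_trans (ler_wpM2l (sqrtr_ge0 _) sF).
have b1 : 1 <= 1 + beta ^+ 2 by rewrite lerDl sqr_ge0.
have b0 := le_trans ler01 b1.
rewrite ge_max; apply/andP; split.
  by rewrite ler_peMl ?enorm_ge0// -[leLHS]sqrtr1; exact: ler_wsqrtr.
rewrite -(@ler_pXn2r _ 2) ?nnegrE ?mulr_ge0 ?enorm_ge0 ?sqrtr_ge0//.
rewrite exprMn [in leRHS]sqr_sqrtr//; apply: le_trans giqn_step_inexact_le _.
by rewrite ler_wpM2r ?sqr_ge0//; lra.
Qed.

End giqn_step_theory.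

(** * Convergence of the method *)

Theorem theorem4 (R : realType) (n : nat) (Omega C : set 'rV[R]_n)
    (F : 'rV[R]_n -> 'rV[R]_n) (alpha sigma etabar : R) (eta theta : nat -> R)
    (x : nat -> 'rV[R]_n) (M : nat -> 'M[R]_n) (r s y st : nat -> 'rV[R]_n)
    (lam : nat -> R) (p : nat -> 'rV[R]_n)
    (hOmega : open Omega) (hF : C1_on Omega F)
    (hCOmega : C `<=` Omega) (hC0 : C !=set0) (hCconv : convex_set C)
    (hCcomp : compact C)
    (halpha : 0 < alpha < 1) (hsigma : 0 < sigma < 1)
    (heta : forall k, 0 < eta k)
    (hetasum : (\sum_(0 <= k <oo) (eta k)%:E <= etabar%:E)%E)
    (htheta : forall j, 0 <= theta j)
    (hx0 : C (x 0%N))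
    (hstep : forall k, giqn_step F C alpha sigma (eta k) (theta k) (x k) (M k)
       (r k) (s k) (y k) (st k) (lam k) (p k) (x k.+1)) :
  [/\ cvgn (fun k => enorm (F (x k))),
      (fun k => lam k * enorm (F (x k))) @ \oo --> (0 : R),
      (infinite_set [set k | enorm (F (x k + p k)) <=
                             (1 - alpha * (1 + lam k)) * enorm (F (x k))] ->
         (fun k => enorm (F (x k))) @ \oo --> (0 : R)) /\
      ((\forall k \near \oo, enorm (F (x k)) <= enorm (F (x k.+1))) ->
         lam @ \oo --> (0 : R) /\ limn (fun k => enorm (F (x k))) <> 0)
    & forall c1 c2 beta : R, 0 < c1 -> 0 <= c2 -> 0 <= beta ->
        (forall k, [/\ M k \in unitmx, opnorm (invmx (M k)) <= c1
                     & enorm (r k) <= c2 * enorm (F (x k))]) ->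
        (forall k, 0 <= theta k <= beta ^+ 2 / 2) ->
        cvgn x].
Proof.
have /andP[a0 _] := halpha.
have e0 k : 0 <= eta k by exact: ltW.
have Cx k : C (x k).
  elim: k => // k Cxk.
  by have [] := giqn_step_accepted hCconv (htheta k) Cxk (hstep k) hsigma
                  (ltW a0) (e0 k).
have step k := giqn_step_accepted hCconv (htheta k) (Cx k) (hstep k) hsigma
                 (ltW a0) (e0 k).
have lam01 k : 0 < lam k <= 1 := giqn_step_length (hstep k) hsigma.
set a := fun k => enorm (F (x k)).
have a_gt0 k : 0 < a k.
  by rewrite lt_def enorm_ge0 enorm_eq0 (giqn_nonstop (hstep k)).
have eE k : series eta k <= etabar.
  rewrite -lee_fin seriesEnat/= -sumEFin; apply: le_trans hetasum.
  by apply: nneseries_lim_ge => i _ _; rewrite lee_fin.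
have [acvg alacvg] : cvgn a /\ cvgn (series (fun k => alpha * (lam k * a k))).
  apply: (quasi_decreasing_cvg _ _ e0 eE) => k.
  - exact: ltW.
  - have /andP[l0 _] := lam01 k.
    by rewrite mulr_ge0 ?mulr_ge0 ?ltW.
  - by have [_ + _] := step k; rewrite -/(a k.+1) -/(a k); lra.
have lacvg : cvgn (series (fun k => lam k * a k)).
  have -> : (fun k => lam k * a k) =
            alpha^-1 *: (fun k => alpha * (lam k * a k)).
    by apply/funext => k; rewrite fctE /GRing.scale/= mulKf ?gt_eqF.
  exact: is_cvg_seriesZ.
have la0 := cvg_series_cvg_0 lacvg.
split=> //.
- split=> [Ainf|ainc].
  + suff aL0 : limn a <= 0.
      have <- : limn a = 0; last exact: acvg.
      by apply/eqP; rewrite eq_le aL0 limr_ge//; near=> k; exact: ltW.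
    have aS : a k.+1 @[k --> \oo] --> limn a by rewrite cvg_shiftS.
    rewrite leNgt; apply/negP => L0.
    (* If the limit L is positive, a k.+1 - (1 - alpha) * a k tends to
       alpha * L > 0, so (A) fails for all large k. *)
    have : \forall k \near \oo, (1 - alpha) * a k < a k.+1.
      have : (fun k => a k.+1 - (1 - alpha) * a k) @ \oo -->
             limn a - (1 - alpha) * limn a.
        by apply: cvgB => //; apply: cvgMl_tmp => //; exact: cvg_cst.
      move=> /cvgr_gt /(_ 0) []; first by nra.
      by move=> N _ gt0; exists N => // k /gt0; rewrite subr_gt0.
    move=> [N _ Nlt].
    have [k Nk] := infinite_set_nat_ge N Ainf.
    rewrite /= -(giqn_next (hstep k)) -/(a k) -/(a k.+1) leNgt => /negP; apply.
    apply: le_lt_trans (Nlt k Nk); rewrite ler_wpM2r ?ltW//.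
    by have /andP[l0 _] := lam01 k; nra.
  + have [N _ aN] := ainc.
    have L0 : 0 < limn a.
      apply: lt_le_trans (a_gt0 N) _; apply: limr_ge => //; exists N => // k /=.
      elim: k => [|k IH]; first by rewrite leqn0 => /eqP ->.
      rewrite leq_eqVlt => /predU1P[->//|]; rewrite ltnS => Nk.
      exact: le_trans (IH Nk) (aN k Nk).
    split; last by apply/eqP; rewrite gt_eqF.
    have -> : lam = (fun k => lam k * a k * (a k)^-1).
      by apply/funext => k; rewrite mulfK ?gt_eqF.
    rewrite -(mul0r (limn a)^-1); apply: cvgM => //.
    by apply: cvgV => //; rewrite gt_eqF.
- move=> c1 c2 beta c10 c20 beta0 hM thetab.
  set K := Num.sqrt (1 + beta ^+ 2) * (c1 * Num.sqrt (2 * (1 + c2 ^+ 2))).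
  apply: (@row_summable_cvg _ _ _ (fun k => K * (lam k * a k))).
    move=> k; have [_ Mc1 rc2] := hM k; have /andP[_ tb] := thetab k.
    apply: le_trans (normr_le_enorm _) _.
    by have := giqn_step_displacement hCconv (htheta k) (Cx k) (hstep k) hsigma
      (ltW a0) (e0 k) (ltW c10) Mc1 rc2 tb.
  exact: is_cvg_seriesZ.
Unshelve. all: by end_near. Qed.
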